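(* There exist finite (non-abelian) simple groups $G$ such that $\delta_{\mathcal{S}}(G)$ is strictly larger than the diameter of the non-generating graph of $G$.
   Context: For a finite insoluble group $G$ with soluble radical $R(G)$ (the largest soluble normal subgroup), the soluble graph $\Gamma_{\mathcal{S}}(G)$ has vertex set $G \setminus R(G)$, with distinct vertices $x,y$ adjacent if and only if the subgroup $\langle x,y\rangle$ is soluble. Its diameter is denoted $\delta_{\mathcal{S}}(G)$ (with $\delta_{\mathcal{S}}(G)=\infty$ if the graph is disconnected). The non-generating graph of a finite group $G$ is the graph on the nontrivial elements of $G$, with distinct $x,y$ adjacent if and only if $G \neq \langle x,y\rangle$. *)

(* Defs.v *)
From mathcomp Require Import all_boot all_fingroup all_solvable.

Set Implicit Arguments.
Unset Strict Implicit.
Unset Printing Implicit Defensive.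

Import GroupScope.

(* Extended natural numbers: [None] stands for infinity. *)
Definition enat_lt (a b : option nat) : bool :=
  match a, b with
  | Some m, Some n => (m < n)%N
  | Some _, None => true
  | None, _ => false
  end.

(* The graph with vertex set [V] and adjacency [e] restricted to [V]. *)
Definition induced (T : finType) (V : {set T}) (e : rel T) : rel T :=
  [rel x y | [&& x \in V, y \in V & e x y]].

Definition walk (T : finType) (V : {set T}) (e : rel T) (n : nat) (x y : T) :=
  [exists p : n.-tuple T, path (induced V e) x p && (last x p == y)].

Lemma connect_walk (T : finType) (V : {set T}) (e : rel T) (x y : T) :
  connect (induced V e) x y -> exists n, walk V e n x y.
Proof.
case/connectP=> p ep ->; exists (size p); apply/existsP; exists (in_tuple p).
by rewrite ep eqxx.
Qed.

Lemma walk_connect (T : finType) (V : {set T}) (e : rel T) n (x y : T) :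
  walk V e n x y -> connect (induced V e) x y.
Proof. by case/existsP=> p /andP[ep /eqP <-]; apply/connectP; exists p. Qed.

Definition graph_dist (T : finType) (V : {set T}) (e : rel T) (x y : T) :
    option nat :=
  if @idP (connect (induced V e) x y) is ReflectT xy
  then Some (ex_minn (connect_walk xy)) else None.

Lemma graph_dist_Some (T : finType) (V : {set T}) (e : rel T) (x y : T) n :
  graph_dist V e x y = Some n <->
  walk V e n x y /\ (forall m, walk V e m x y -> (n <= m)%N).
Proof.
rewrite /graph_dist; case: {-}_ / idP => [xy | nxy].
  case: ex_minnP => d wd mind; split=> [[<-] // | [wn minn]].
  by congr Some; apply/eqP; rewrite eqn_leq mind // minn.
by split=> // -[/walk_connect].
Qed.

Lemma graph_dist_None (T : finType) (V : {set T}) (e : rel T) (x y : T) :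
  graph_dist V e x y = None <-> ~~ connect (induced V e) x y.
Proof.
rewrite /graph_dist; case: {-}_ / idP => [xy | /negP nxy]; last by split.
by split=> //; rewrite xy.
Qed.

Definition graph_diam (T : finType) (V : {set T}) (e : rel T) : option nat :=
  if [forall x in V, forall y in V, graph_dist V e x y != None]
  then Some (\max_(x in V) \max_(y in V) odflt 0 (graph_dist V e x y))
  else None.

(* The soluble radical, as the join of all soluble normal subgroups; the     *)
(* lemmas below show that it is the largest soluble normal subgroup.         *)
Definition sol_radical (gT : finGroupType) (G : {set gT}) : {set gT} :=
  <<\bigcup_(H : {group gT} | (H <| G) && solvable H) H>>.

Lemma sol_radical_max (gT : finGroupType) (G H : {group gT}) :
  H <| G -> solvable H -> H \subset sol_radical G.
Proof.
move=> nHG solH; apply: sub_gen.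
by apply: (bigcup_max H) => //; rewrite nHG.
Qed.

Lemma sol_radical_normal_sol (gT : finGroupType) (G : {group gT}) :
  sol_radical G <| G /\ solvable (sol_radical G).
Proof.
suff [R [nRG solR ->]] : exists R : {group gT},
    [/\ R <| G, solvable R & sol_radical G = R] by [].
have solY (H K : {group gT}) : H <| G -> K <| G ->
    solvable H -> solvable K -> solvable (H <*> K).
  move=> nHG nKG solH solK.
  have nHK : K \subset 'N(H).
    exact: subset_trans (normal_sub nKG) (normal_norm nHG).
  have nY : H <| H <*> K by rewrite normalYl.
  rewrite (series_sol nY) solH /= quotientYidl //.
  exact: quotient_sol.
pose P (H : {group gT}) := (H <| G) && solvable H.
have P1 : P 1%G by rewrite /P normal1 solvable1.
have [R /maxgroupP[/andP[nRG solR] maxR] _] := maxgroup_exists P1.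
exists R; split=> //; apply/eqP; rewrite eqEsubset sol_radical_max // andbT.
rewrite gen_subG; apply/bigcupsP=> H /andP[nHG solH].
rewrite -(maxR (H <*> R)%G) ?joing_subl ?joing_subr //.
by rewrite /P /= normalY //= solY.
Qed.

Definition soluble_adj (gT : finGroupType) : rel gT :=
  [rel x y | (x != y) && solvable <<[set x; y]>>].

Definition soluble_graph_diam (gT : finGroupType) (G : {set gT}) :
    option nat :=
  graph_diam (G :\: sol_radical G) (@soluble_adj gT).

Definition nongen_adj (gT : finGroupType) (G : {set gT}) : rel gT :=
  [rel x y | (x != y) && (G != <<[set x; y]>>)].

Definition nongen_graph_diam (gT : finGroupType) (G : {set gT}) :
    option nat :=
  graph_diam G^# (nongen_adj G).

(* Main.v *)
Require Import Defs.
From mathcomp Require Import all_boot all_fingroup all_solvable.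

(* The simple group is Alt_6.  In its non-generating graph any two vertices  *)
(* are at distance at most 2: an even permutation of 6 points is not         *)
(* transitive, so x and y lie in the (proper) stabilisers of sets A and B,   *)
(* and some nontrivial even permutation stabilises both A and B.             *)
(* In the soluble graph the neighbours of an element x of order 5 normalise  *)
(* <x>: a minimal normal subgroup N of a soluble group containing x has      *)
(* prime power order dividing 360, hence |N| is not 1 mod 5, so x centralises*)
(* a nontrivial element of N; as x generates its centraliser, N = <x>.  The  *)
(* subgroups generated by (0 1 2 3 4) and (0 1 3 2 5) have normalisers which *)
(* meet trivially, so these two elements are at distance at least 3.         *)

Set Implicit Arguments.
Unset Strict Implicit.
Unset Printing Implicit Defensive.

Import GroupScope.

(** Both halves compare the two graphs on ['Alt_('I_6)] at the value 2. [nongen_diam_Alt] bounds the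
    non-generating diameter by 2: for x, y stabilising A, B ([Alt_stab_exists]), a nontrivial even g
    stabilising both ([Alt_stabI_neq1]) gives the path x, g, y. For the soluble graph,
    [soluble_norm_cycle5] turns solubility of the group generated by a 5-cycle and z into the
    condition that z normalises the cycle's group. [far_cycles5] finds two 5-cycles for which only z
    = 1 meets both conditions, and 1 is not a vertex. *)

Section Graphs.

Variables (T : finType) (V : {set T}) (e : rel T).

Lemma walkP n (x y : T) :
  reflect (exists p : seq T,
             [/\ size p = n, path (induced V e) x p & last x p = y])
          (walk V e n x y).
Proof.
apply: (iffP existsP) => [[p /andP[ep /eqP lp]] | [p [sp ep lp]]].
  by exists p; rewrite size_tuple.
by have sp' := introT eqP sp; exists (Tuple sp'); rewrite /= ep lp eqxx.
Qed.

Lemma graph_diam_le d :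
    {in V &, forall x y, exists2 n, walk V e n x y & n <= d} ->
  exists2 m, graph_diam V e = Some m & m <= d.
Proof.
move=> short.
have distV : {in V &, forall x y,
    exists2 n, graph_dist V e x y = Some n & n <= d}.
  move=> x y xV yV; have [n wn le_nd] := short x y xV yV.
  case Dd: (graph_dist V e x y) => [k|].
    exists k => //; have /graph_dist_Some[_ /(_ n wn) le_kn] := Dd.
    exact: leq_trans le_kn le_nd.
  by have /graph_dist_None := Dd; rewrite (walk_connect wn).
rewrite /graph_diam ifT; last first.
  apply/forall_inP=> x xV; apply/forall_inP=> y yV.
  by have [n ->] := distV x y xV yV.
eexists; first by [].
apply/bigmax_leqP=> x xV; apply/bigmax_leqP=> y yV.
by have [n ->] := distV x y xV yV.
Qed.

Lemma graph_diam_gt d (x y : T) :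
    x \in V -> y \in V -> (forall n, walk V e n x y -> d < n) ->
  enat_lt (Some d) (graph_diam V e).
Proof.
move=> xV yV far; rewrite /graph_diam.
(* A disconnected graph has infinite diameter, which exceeds [d] at once. *)
case: ifP => //= /forall_inP/(_ x xV)/forall_inP/(_ y yV).
case Dd: (graph_dist V e x y) => [n|] // _.
have /graph_dist_Some[/far lt_dn _] := Dd.
apply: leq_trans (leq_bigmax_cond _ xV).
by apply: leq_trans (leq_bigmax_cond _ yV); rewrite Dd.
Qed.

End Graphs.

(** * The non-generating graph of an alternating group of even degree *)

Section NongenAlt.

Variable T : finType.

Lemma Alt_stab_proper (A : {set T}) :
  2 < #|T| -> A != set0 -> A != setT -> ~~ ('Alt_T \subset 'N(A | 'P)).
Proof.
move=> cardT /set0Pn[a aA]; rewrite -subTset => /subsetPn[b _ bNA].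
have trT : [transitive 'Alt_T, on setT | 'P].
  by apply: ntransitive1 (Alt_trans T); rewrite -subn2 subn_gt0.
have [g gAlt /= Db] := atransP2 trT (in_setT a) (in_setT b).
apply/subsetPn; exists g => //; apply/astabsP=> /(_ a).
by rewrite /= apermE in Db *; rewrite -Db aA (negPf bNA).
Qed.

(* For #|T| even, an even permutation has an even number of orbits. *)
Lemma Alt_stab_exists (s : {perm T}) :
    0 < #|T| -> ~~ odd #|T| -> s \in 'Alt_T ->
  exists A : {set T}, [/\ A != set0, A != setT & s \in 'N(A | 'P)].
Proof.
case/card_gt0P=> a _ evT; rewrite Alt_even /odd_perm (negPf evT) /= => evs.
exists (porbit s a); split.
- by apply/set0Pn; exists a; apply: porbit_id.
- apply: contraNneq evs => orbT.
  (* A full orbit would be the only one, and 1 is odd. *)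
  suff -> : porbits s = [set setT] by rewrite cards1.
  apply/setP=> B; rewrite inE; apply/imsetP/eqP=> [[b _ ->] | ->].
    by rewrite -orbT; apply/eqP; rewrite eq_porbit_mem orbT inE.
  by exists a; rewrite ?orbT.
apply/astabsP=> b /=; rewrite -!eq_porbit_mem.
by rewrite -(porbit_perm s 1 b) expg1.
Qed.

(* Five points cannot be separated by membership in A and in B, and this     *)
(* yields two different transpositions stabilising both A and B.             *)
Lemma Alt_stabI_neq1 (A B : {set T}) :
  5 < #|T| -> exists2 g, g \in ('Alt_T)^# & g \in 'N(A | 'P) :&: 'N(B | 'P).
Proof.
move=> cardT; pose f (t : T) := (t \in A, t \in B).
have coll (D : {set T}) :
    4 < #|D| -> exists a b : T, [/\ a \in D, b \in D, a != b & f a = f b].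
  move=> cardD; have /dinjectivePn[a aD [b]] : ~~ dinjectiveb f (mem D).
    (* Pigeonhole: [f] takes at most four values. *)
    apply: contraL cardD => /dinjectiveP injf; rewrite -leqNgt.
    rewrite -(card_in_imset injf); apply: leq_trans (max_card _) _.
    by rewrite card_prod !card_bool.
  by case/andP=> ba bD fab; exists a, b; split; rewrite // eq_sym.
have [a [b [_ _ ab fab]]] : exists a b : T,
    [/\ a \in setT, b \in setT, a != b & f a = f b].
  by apply: coll; rewrite cardsT ltnW.
(* Excluding a makes (c d) fix a, so it differs from (a b) and the product is nontrivial; c or d may
   still equal b. *)
have [c [d [ca da cd fcd]]] : exists c d : T,
    [/\ c \in [set~ a], d \in [set~ a], c != d & f c = f d].
  by apply: coll; rewrite cardsC1 -ltnS prednK // (leq_trans _ cardT).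
rewrite !inE in ca da.
have ftp u v t : f u = f v -> f (tperm u v t) = f t.
  by move=> fuv; case: tpermP => [-> | -> |] //.
exists (tperm a b * tperm c d).
  rewrite in_setD1 Alt_even odd_permM !odd_tperm ab cd andbT /=.
  rewrite -eq_invg_mul tpermV; apply/eqP=> /permP/(_ a).
  by rewrite tpermL tpermD // => Dba; rewrite Dba eqxx in ab.
have ff t : f ((tperm a b * tperm c d) t) = f t by rewrite permM !ftp.
by apply/setIP; split; apply/astabsP=> t /=; have [] := ff t.
Qed.

Lemma nongen_diam_Alt :
    5 < #|T| -> ~~ odd #|T| ->
  exists2 m, nongen_graph_diam 'Alt_T = Some m & m <= 2.
Proof.
move=> cardT evT; have cardT2 : 2 < #|T| by apply: leq_trans cardT.
have cardT0 := ltnW (ltnW cardT2).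
apply: graph_diam_le => x y xV yV; have [_ xG] := setD1P xV.
have [_ yG] := setD1P yV.
have [A [A0 AT xA]] := Alt_stab_exists cardT0 evT xG.
have [B [B0 BT yB]] := Alt_stab_exists cardT0 evT yG.
have [g gV /setIP[gA gB]] := Alt_stabI_neq1 A B cardT.
have proper (C : {set T}) (u v : {perm T}) : C != set0 -> C != setT ->
    u \in 'N(C | 'P) -> v \in 'N(C | 'P) -> 'Alt_T != <<[set u; v]>>.
  move=> C0 CT uC vC; apply: contraNneq (Alt_stab_proper cardT2 C0 CT) => ->.
  by rewrite gen_subG subUset !sub1set uC vC.
have step (u v : {perm T}) : u \in ('Alt_T)^# -> v \in ('Alt_T)^# -> u != v ->
    'Alt_T != <<[set u; v]>> -> induced ('Alt_T)^# (nongen_adj 'Alt_T) u v.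
  by move=> uV vV neq_uv nongen; apply/and3P; split=> //; apply/andP.
(* Adjacency demands distinct vertices, so coincidences among x, g, y give shorter walks. *)
have [<- | neq_xy] := eqVneq x y.
  by exists 0 => //; apply/walkP; exists [::].
have [Dg | neq_xg] := eqVneq x g.
  exists 1%N => //; apply/walkP; exists [:: y]; split=> //.
  by apply/andP; split=> //; apply: step => //; apply: (proper B); rewrite ?Dg.
have [Dg | neq_gy] := eqVneq g y.
  exists 1%N => //; apply/walkP; exists [:: y]; split=> //.
  by apply/andP; split=> //; apply: step => //; apply: (proper A); rewrite -?Dg.
exists 2 => //; apply/walkP; exists [:: g; y]; split=> //.
apply/and3P; split=> //; apply: step => //; first exact: (proper A).
exact: (proper B).
Qed.

End NongenAlt.

(** Conjugation by P on a minimal normal r-subgroup N has a number of fixed points congruent to the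
    order of N mod p. The last hypothesis makes ['C_N(P)] nontrivial; it lies in P, so P is inside
    N. Then r = p, and N = P as p^2 does not divide the order of H. *)
Lemma self_cent_prime_normal (gT : finGroupType) (p : nat) (H P : {group gT}) :
    solvable H -> P \subset H -> #|P| = p -> prime p -> 'C_H(P) \subset P ->
    ~~ (p ^ 2 %| #|H|) ->
    (forall r k, prime r -> 0 < k -> r ^ k %| #|H| -> r ^ k != 1 %[mod p]) ->
  P <| H.
Proof.
move=> solH sPH oP pr_p cP p2H modp.
have ntH : H :!=: 1.
  apply: contraTneq pr_p => H1; rewrite -oP.
  by move: sPH; rewrite H1 => /trivgP->; rewrite cards1.
have [N minN sNH] := minnormal_exists ntH (normG H).
have [nNH ntN abN] := minnormal_solvable minN sNH solH.
have [pr_r _ [k oN]] := pgroup_pdiv (abelem_pgroup abN) ntN.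
move: (pdiv _) pr_r oN => r pr_r oN.
have nNP : P \subset 'N(N) := subset_trans sPH nNH.
have pP : p.-group P by rewrite /pgroup oP pnat_id.
have actP : [acts P, on N | 'J] by rewrite astabsJ.
have := pgroup_fix_mod pP actP; rewrite afixJ => fixN.
have ntC : 'C_N(P) != 1.
  apply/eqP=> C1; rewrite C1 cards1 oN in fixN.
  have := modp _ k.+1 pr_r isT; rewrite -oN cardSg // oN fixN eqxx.
  by move/(_ isT).
have sPN : P \subset N.
  rewrite prime_meetG ?oP //; apply: contraNneq ntC => PN1.
  rewrite -subG1 -PN1 subsetI subsetIl andbT.
  exact: subset_trans (setSI _ sNH) cP.
suff <- : N :=: P by rewrite /normal sNH nNH.
apply/eqP; rewrite eq_sym eqEcard sPN oP oN.
have := cardSg sPN; rewrite oP oN Euclid_dvdX // => /andP[].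
rewrite dvdn_prime2 // => /eqP Dp _; rewrite -Dp in oN *.
case: k oN => [|k] oN; first by rewrite expn1 leqnn.
case/negP: p2H; apply: dvdn_trans (cardSg sNH).
by rewrite oN dvdn_exp2l.
Qed.

Lemma order5_Alt (T : finType) (x : {perm T}) : #[x] = 5 -> x \in 'Alt_T.
Proof.
(* As x^6 = x, x is a square, hence even. *)
move=> ox; have {1}-> : x = x ^+ 3 * x ^+ 3.
  by rewrite -expgD (expgSr x 5) -ox expg_order mul1g.
by rewrite Alt_even odd_permM addbb.
Qed.

(** * Permutations with one fixed point and one other cycle *)

Section SingleCycle.

Variables (T : finType) (x : {perm T}) (o a : T).
Hypotheses (xo : x o = o) (xa : x a != a).
Hypothesis orbx : forall t, t != o -> exists i, t = (x ^+ i) a.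

Lemma fixed_single_cycle t : x t = t -> t = o.
Proof.
move=> xt; apply/eqP; apply: contraNT xa => /orbx[i Dt].
apply/eqP/(@perm_inj _ (x ^+ i)).
by rewrite -permM -expgS expgSr permM -Dt.
Qed.

Lemma cent_single_cycle c : commute c x -> c \in <[x]>.
Proof.
move=> cx.
have cxX i t : c ((x ^+ i) t) = (x ^+ i) (c t).
  by rewrite -!permM; congr fun_of_perm; apply/esym/commuteX.
have co : c o = o.
  by apply: fixed_single_cycle; have := cxX 1%N o; rewrite expg1 xo.
have [|i Dca] := orbx (t := c a).
  rewrite -[X in _ != X]co (inj_eq perm_inj).
  by apply: contraNneq xa => ->; rewrite xo.
apply/cycleP; exists i; apply/permP=> t.
have [-> | /orbx[j ->]] := eqVneq t o.
  rewrite co; elim: i {Dca} => [|i IHi]; first by rewrite perm1.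
  by rewrite expgSr permM -IHi xo.
by rewrite cxX Dca -!permM -!expgD addnC.
Qed.

Lemma norm_single_cycle_fix z : z \in 'N(<[x]>) -> z o = o.
Proof.
move=> nxz; have /cycleP[k xz] : x ^ z^-1 \in <[x]>.
  by rewrite memJ_norm ?groupV // cycle_id.
(* x^k fixes o, so its conjugate x fixes z o; but o is the only fixed point of x. *)
apply: fixed_single_cycle; have <- : (x ^+ k) ^ z = x by rewrite -xz conjgKV.
rewrite -permM conjgE !mulgA mulgV mul1g permM; congr (z _).
by elim: k {xz} => [|k IHk]; rewrite ?perm1 // expgSr permM IHk.
Qed.

Lemma soluble_norm_cycle5 z :
    #|T| = 6 -> #[x] = 5 -> z \in 'Alt_T -> solvable <<[set x; z]>> ->
  z \in 'N(<[x]>).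
Proof.
move=> cardT ox zAlt solH.
have xAlt := order5_Alt ox.
set H := <<[set x; z]>>%G in solH.
have sHA : H \subset 'Alt_T by rewrite gen_subG subUset !sub1set xAlt.
have dvdH : #|H| %| 360.
  have := cardSg sHA; suff -> : #|'Alt_T| = 360 by [].
  by apply/eqP; rewrite -(eqn_pmul2l (isT : 0 < 2)) card_Alt cardT.
have xH : x \in H by rewrite mem_gen ?set21.
suff /normal_norm/subsetP : <[x]> <| H by apply; rewrite mem_gen ?set22.
apply: (@self_cent_prime_normal _ 5) => //=.
- by rewrite cycle_subG.
- apply/subsetP=> c /setIP[_]; rewrite cent_cycle => /cent1P.
  exact: cent_single_cycle.
- by apply/negP=> /dvdn_trans/(_ dvdH).
move=> r k pr_r k_gt0 /dvdn_trans/(_ dvdH) dvd360.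
apply/negP=> eq1.
(* This list is 1, 6, 36: a positive power of a prime is not 1 and is not divisible by 6. *)
have : (r ^ k)%N \in [seq d <- divisors 360 | d == 1 %[mod 5]].
  by rewrite mem_filter eq1 -dvdn_divisors.
have pr23 : ~ (6 %| r ^ k).
  rewrite (@Gauss_dvd 2 3) // !Euclid_dvdX // k_gt0 !andbT !dvdn_prime2 //.
  by case/andP=> /eqP<-.
rewrite [filter _ _]/= !inE => /or3P[] /eqP Drk; try by rewrite Drk in pr23.
by have := ltn_expl k (prime_gt1 pr_r); rewrite Drk ltnNge k_gt0.
Qed.

End SingleCycle.

(** * Computing with permutations of six points through lists of values *)

Section SixPoints.

Implicit Types (s : seq nat) (x z : {perm 'I_6}).

(* A boolean test that the permutation of 0, ..., 5 with list of values s is *)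
(* a 5-cycle through a fixing o.                                             *)
Definition cycle5_code s o a :=
  [&& nth 0 s o == o, nth 0 s a != a
    & all (fun t => (iter 5 (nth 0 s) t == t) &&
             ((t == o) || has (fun i => t == iter i (nth 0 s) a) (iota 0 5)))
          (iota 0 6)].

Definition codes x s := forall t, x t = nth 0 s t :> nat.

Lemma perm_code s : perm_eq s (iota 0 6) -> exists x, codes x s.
Proof.
move=> s6; have sz : size s = 6 by rewrite (perm_size s6).
have lt6 (t : 'I_6) : nth 0 s t < 6.
  have: nth 0 s t \in s by rewrite mem_nth ?sz.
  by rewrite (perm_mem s6) mem_iota.
have inj : injective (fun i : 'I_6 => inord (nth 0 s i) : 'I_6).
  move=> i j /(congr1 (@nat_of_ord 6)); rewrite !inordK // => /eqP.
  rewrite nth_uniq ?sz ?(perm_uniq s6) // => /eqP; exact: val_inj.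
by exists (perm inj) => t; rewrite permE inordK.
Qed.

Section Code.

Variables (x : {perm 'I_6}) (s : seq nat) (o a : 'I_6).
Hypotheses (xs : codes x s) (sP : cycle5_code s o a).

Lemma codesX k t : (x ^+ k) t = iter k (nth 0 s) t :> nat.
Proof. by rewrite permX; elim: k => //= k <-; apply: xs. Qed.

Lemma cycle5_codeP :
  [/\ x o = o, x a != a & forall t, t != o -> exists i, t = (x ^+ i) a].
Proof.
case/and3P: sP => /eqP so sa /allP orb; split.
- by apply: val_inj; rewrite /= xs.
- by rewrite -val_eqE /= xs.
move=> t to; have := orb t; rewrite mem_iota ltn_ord => /(_ isT)/andP[_].
rewrite val_eqE (negPf to) => /hasP[i _ /eqP Dt]; exists i.
by apply: val_inj; rewrite /= codesX.
Qed.

Lemma cycle5_code_order : #[x] = 5.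
Proof.
have [_ xa _] := cycle5_codeP; apply/prime_nt_dvdP => //.
  by rewrite order_eq1; apply: contraNneq xa => ->; rewrite perm1.
rewrite order_dvdn; apply/eqP/permP=> t.
apply: val_inj; rewrite perm1 /= codesX.
case/and3P: sP => _ _ /allP/(_ t).
by rewrite mem_iota ltn_ord => /(_ isT)/andP[/eqP].
Qed.

(** The equation is x^z = x^k evaluated at z i: one exponent k propagates the value of z along the
    whole cycle. *)
Lemma norm_cycle5_code z : z \in 'N(<[x]>) ->
  z o = o /\
  exists2 k, k < 5 & forall i, i < 6 ->
    z (inord (nth 0 s i)) = iter k (nth 0 s) (z (inord i)) :> nat.
Proof.
have [xo xa orb] := cycle5_codeP.
move=> nxz; split; first exact (norm_single_cycle_fix xo xa orb nxz).
have: x ^ z \in <[x]> by rewrite memJ_norm ?cycle_id.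
case/cyclePmin=> k; rewrite cycle5_code_order => lt_k5 xz.
exists k => // i lt_i6.
rewrite -codesX -xz -permM conjgE !mulgA mulgV mul1g permM.
by rewrite -{1}(inordK lt_i6) -xs inord_val.
Qed.

End Code.

End SixPoints.

(** * Two distant vertices in the soluble graph of Alt_6 *)

Lemma sol_radical_Alt (T : finType) : 4 < #|T| -> sol_radical 'Alt_T = 1.
Proof.
move=> cardT; have [nRA solR] := sol_radical_normal_sol 'Alt_T.
rewrite /sol_radical in nRA solR *.
have [_ /(_ _ nRA)[//|RA]] := simpleP _ (simple_Alt5 cardT).
by rewrite RA solvable_AltF in solR.
Qed.

(* The two 5-cycles are x = (0 1 2 3 4) and y = (0 1 3 2 5).                 *)
Lemma far_cycles5 : exists x y : {perm 'I_6},
  [/\ #[x] = 5, #[y] = 5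
  & forall z, z \in 'Alt_('I_6) -> solvable <<[set x; z]>> ->
      solvable <<[set z; y]>> -> z = 1].
Proof.
pose s1 := [:: 1%N; 2; 3; 4; 0; 5]; pose s2 := [:: 1%N; 3; 5; 2; 4; 0].
have [//|x xs] := @perm_code s1; have [//|y ys] := @perm_code s2.
pose o n : 'I_6 := inord n.
have cx : cycle5_code s1 (o 5) (o 0) by rewrite !inordK.
have cy : cycle5_code s2 (o 4) (o 0) by rewrite !inordK.
have ox := cycle5_code_order xs cx; have oy := cycle5_code_order ys cy.
exists x, y; split=> // z zAlt solx soly.
have card6 : #|'I_6| = 6 by apply: card_ord.
have [xo xa orbx] := cycle5_codeP xs cx.
have [yo ya orby] := cycle5_codeP ys cy.
have nxz := soluble_norm_cycle5 xo xa orbx card6 ox zAlt solx.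
rewrite setUC in soly.
have nyz := soluble_norm_cycle5 yo ya orby card6 oy zAlt soly.
have [z5 [k lt_k5 zx]] := norm_cycle5_code xs cx nxz.
have [z4 [l lt_l5 zy]] := norm_cycle5_code ys cy nyz.
pose v n : nat := z (o n).
have v5 : v 5 = 5 by rewrite /v z5 inordK.
have v4 : v 4 = 4 by rewrite /v z4 inordK.
(* z fixes 5 (missed by x) and 4 (missed by y). Starting from 4, k determines z on the cycle of x;
   starting from 5, l determines z 0 and z 1 a second time. *)
have x0 : v 0 = iter k (nth 0 s1) 4 by rewrite -[in RHS]v4; apply: zx 4 isT.
have x1 : v 1%N = iter k (nth 0 s1) (v 0) := zx 0 isT.
have x2 : v 2 = iter k (nth 0 s1) (v 1%N) := zx 1%N isT.
have x3 : v 3 = iter k (nth 0 s1) (v 2) := zx 2 isT.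
have y0 : v 0 = iter l (nth 0 s2) 5 by rewrite -[in RHS]v5; apply: zy 5 isT.
have y1 : v 1%N = iter l (nth 0 s2) (v 0) := zy 0 isT.
suff vE n : n < 6 -> v n = n.
  apply/permP=> t; apply: val_inj.
  by rewrite perm1 /= -[RHS]vE // /v /o inord_val.
rewrite x0 in x1 y0 y1; rewrite x1 in x2 y1; rewrite x2 in x3.
(* Of the 25 pairs (k, l) only k = l = 1 gives consistent values of z 0 and z 1, and then z is the
   identity. *)
case: k lt_k5 x0 x1 x2 x3 y0 y1 {zx} => [|[|[|[|[|]]]]] // _ x0 x1 x2 x3;
  case: l lt_l5 {zy} => [|[|[|[|[|]]]]] // _ _ _.
by case: n => [|[|[|[|[|[|]]]]]].
Qed.

Lemma soluble_diam_Alt6 : enat_lt (Some 2) (soluble_graph_diam 'Alt_('I_6)).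
Proof.
have [x [y [ox oy far]]] := far_cycles5.
have rad1 : sol_radical 'Alt_('I_6) = 1.
  by apply: sol_radical_Alt; rewrite card_ord.
have V5 z : #[z] = 5 -> z \in 'Alt_('I_6) :\: sol_radical 'Alt_('I_6).
  by move=> oz; rewrite rad1 in_setD1 order5_Alt // -order_eq1 oz.
have far1 z : z \in 'Alt_('I_6) :\: sol_radical 'Alt_('I_6) ->
    solvable <<[set x; z]>> -> ~~ solvable <<[set z; y]>>.
  rewrite rad1 in_setD1 => /andP[z1 zAlt] solx; apply: contra z1 => soly.
  by rewrite (far z).
have sol1 (z : {perm 'I_6}) : solvable <<[set z; z]>>.
  by rewrite setUid abelian_sol ?cycle_abelian.
apply: (graph_diam_gt (V5 x ox) (V5 y oy)) => n /walkP[p [<- {n} ep lp]].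
(* Walks of length 0 and 1 are refuted like those of length 2, with x, respectively y, as the middle
   vertex. *)
rewrite ltnNge; apply/negP=> le_p2; case: p ep lp le_p2 => [|z [|w []]] //=.
- by move=> _ Dx _; case/negP: (far1 _ (V5 x ox) (sol1 x)); rewrite Dx.
- case/andP=> /and3P[_ zV /andP[_ solxz]] _ Dz _.
  by case/negP: (far1 _ zV solxz); rewrite Dz.
case/and3P=> /and3P[_ zV /andP[_ solxz]] /and3P[_ _ /andP[_ solzw]] _ Dw _.
by case/negP: (far1 _ zV solxz); rewrite -Dw.
Qed.

Theorem corollary5p8 :
  exists (gT : finGroupType) (G : {group gT}),
    [/\ simple G, ~~ abelian G
      & enat_lt (nongen_graph_diam G) (soluble_graph_diam G)].
Proof.
have card6 : #|'I_6| = 6 by apply: card_ord.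
exists _, 'Alt_('I_6)%G; split.
- by apply: simple_Alt5; rewrite card6.
- by apply: contraFN (solvable_AltF (T := 'I_6) _); rewrite ?card6 //;
    apply: abelian_sol.
have [||m -> le_m2] := @nongen_diam_Alt 'I_6; rewrite ?card6 //=.
by case: soluble_graph_diam soluble_diam_Alt6 => //= n; apply: leq_ltn_trans.
Qed.
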